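(* Let $p$ be a prime number and let $n$ be a positive integer such that $\gcd(n,p)=1$. If $n$ is $p$-multiperfect and $p$-layered, then $pn$ is $(p+1)$-multiperfect and $(p+1)$-layered.
   Context: $\sigma(n)$ denotes the sum of the positive divisors of $n$. A positive integer $n$ is $k$-multiperfect if $\sigma(n)=kn$. A positive integer $n$ is $k$-layered if the set of all positive divisors of $n$ can be partitioned into $k$ subsets having the same sum of elements. *)

(* Defs.v *)
From mathcomp Require Import all_boot.

Set Implicit Arguments.
Unset Strict Implicit.
Unset Printing Implicit Defensive.

Definition sigma (n : nat) : nat := \sum_(d <- divisors n) d.

Definition multiperfect (k n : nat) : Prop := 0 < n /\ sigma n = k * n.

(* 'I_n.+1 is large enough to hold every positive divisor of n. *)
Definition divisor_set (n : nat) : {set 'I_n.+1} :=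
  [set d : 'I_n.+1 | val d \in divisors n].

(* [partition] demands nonempty blocks, which loses nothing here: an empty
   block would force all block sums to be 0, while the divisors sum to at
   least 1. *)
Definition layered (k n : nat) : Prop :=
  0 < n /\
  exists P : {set {set 'I_n.+1}},
    [/\ partition P (divisor_set n),
        #|P| = k
      & forall A B : {set 'I_n.+1}, A \in P -> B \in P ->
          \sum_(d in A) val d = \sum_(d in B) val d].

(* Main.v *)
(** The divisors of [p * n] are those of [n], with sum [p * n], together with
    their multiples by [p]. A partition of the divisors of [n] into [p] blocks
    of equal sum has blocks of sum [n], which multiplication by [p] turns into
    blocks of sum [p * n]; the divisors of [n] themselves are the extra block. *)
Require Import Defs.
From mathcomp Require Import all_boot.

(** Divisors of [n] and of [p * n] live in different ordinal types, so even the inclusion needs a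
    map: it is the case [a = 1]. [inord] falls back to 0 out of range, hence the bound [a * n <= m]
    in the lemmas below. *)
Definition scale_ord (a m n : nat) (d : 'I_n.+1) : 'I_m.+1 := inord (a * d).

Lemma val_scale_ord (a m n : nat) (d : 'I_n.+1) :
  a * n <= m -> scale_ord a m n d = a * d :> nat.
Proof.
move=> le_an_m; rewrite inordK // ltnS (leq_trans _ le_an_m) //.
by rewrite leq_mul2l -ltnS ltn_ord orbT.
Qed.

Lemma scale_ord_inj (a m n : nat) :
  0 < a -> a * n <= m -> injective (scale_ord a m n).
Proof.
move=> a_gt0 le_an_m d e /(congr1 val); rewrite /= !val_scale_ord // => /eqP.
by rewrite eqn_pmul2l // => /eqP/val_inj.
Qed.

Lemma sum_scale_ord (a m n : nat) (A : {set 'I_n.+1}) :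
    0 < a -> a * n <= m ->
  \sum_(d in scale_ord a m n @: A) val d = a * \sum_(d in A) val d.
Proof.
move=> a_gt0 le_an_m; rewrite big_imset; last first.
  by move=> d e _ _; apply: scale_ord_inj.
by rewrite big_distrr; apply: eq_bigr => d _; apply: val_scale_ord.
Qed.

Lemma mem_divisor_set (n : nat) (d : 'I_n.+1) :
  0 < n -> (d \in divisor_set n) = (d %| n).
Proof. by move=> n_gt0; rewrite inE -dvdn_divisors. Qed.

Lemma sum_divisor_set (n : nat) :
  0 < n -> \sum_(d in divisor_set n) val d = sigma n.
Proof.
move=> n_gt0; rewrite -big_enum -(big_map val xpredT (fun d => d)).
apply/perm_big/uniq_perm; rewrite ?divisors_uniq //.
  by rewrite (map_inj_uniq val_inj) enum_uniq.
move=> d; apply/mapP/idP => [[e]|d_div].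
  by rewrite mem_enum inE => e_div ->.
have lt_d_n : d < n.+1 by rewrite ltnS dvdn_leq // dvdn_divisors.
by exists (Ordinal lt_d_n); rewrite // mem_enum inE.
Qed.

(** A divisor of [p * n] that is a multiple [e * p] gives [e %| n] by cancelling [p]; any other is
    coprime to [p], hence divides [n] by Gauss. *)
Lemma divisor_set_prime_mul (p n : nat) :
    prime p -> 0 < n ->
  divisor_set (p * n) =
    scale_ord 1 (p * n) n @: divisor_set n
      :|: scale_ord p (p * n) n @: divisor_set n.
Proof.
move=> p_prime n_gt0; have p_gt0 := prime_gt0 p_prime.
have le1 : 1 * n <= p * n by rewrite leq_mul2r p_gt0 orbT.
have pn_gt0 : 0 < p * n by rewrite muln_gt0 p_gt0.
apply/setP=> d; rewrite in_setU mem_divisor_set //.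
apply/idP/orP => [d_dvd|]; last first.
  case=> /imsetP[e]; rewrite mem_divisor_set // => e_dvd ->.
    by rewrite val_scale_ord // mul1n dvdn_mull.
  by rewrite val_scale_ord // dvdn_pmul2l.
have [/dvdnP[e def_d]|p'd] := boolP (p %| d); [right|left].
  have e_dvd : e %| n by rewrite -(dvdn_pmul2l p_gt0) mulnC -def_d.
  have lt_e : e < n.+1 by rewrite ltnS dvdn_leq.
  apply/imsetP; exists (Ordinal lt_e); first by rewrite mem_divisor_set.
  by apply: val_inj; rewrite /= val_scale_ord //= def_d mulnC.
have d_dvd_n : d %| n.
  by rewrite -(Gauss_dvdr (m := d) (n := p)) // coprime_sym prime_coprime.
have lt_d : d < n.+1 by rewrite ltnS dvdn_leq.
apply/imsetP; exists (Ordinal lt_d); first by rewrite mem_divisor_set.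
by apply: val_inj; rewrite /= val_scale_ord //= mul1n.
Qed.

(** A common element would be a divisor of [n] that is a multiple of [p]. *)
Lemma disjoint_divisor_set_scale (p n : nat) :
    prime p -> 0 < n -> coprime n p ->
  [disjoint scale_ord 1 (p * n) n @: divisor_set n
          & scale_ord p (p * n) n @: divisor_set n].
Proof.
move=> p_prime n_gt0 co_np; have p_gt0 := prime_gt0 p_prime.
have le1 : 1 * n <= p * n by rewrite leq_mul2r p_gt0 orbT.
apply/pred0P=> x /=; apply/negP=> /andP[/imsetP[d + ->] /imsetP[e _]].
rewrite mem_divisor_set // => d_dvd /(congr1 val).
rewrite /= !val_scale_ord // mul1n => def_d.
have : p %| n by apply: dvdn_trans d_dvd; rewrite def_d dvdn_mulr.
by apply/negP; rewrite -prime_coprime // coprime_sym.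
Qed.

Lemma sigma_prime_mul (p n : nat) :
  prime p -> 0 < n -> coprime n p -> sigma (p * n) = p.+1 * sigma n.
Proof.
move=> p_prime n_gt0 co_np; have p_gt0 := prime_gt0 p_prime.
have le1 : 1 * n <= p * n by rewrite leq_mul2r p_gt0 orbT.
rewrite -!sum_divisor_set ?muln_gt0 ?p_gt0 // divisor_set_prime_mul //.
rewrite (eq_bigl _ _ (fun d => in_setU d _ _)) bigU /=; last first.
  exact: disjoint_divisor_set_scale.
by rewrite !sum_scale_ord // mul1n mulSn.
Qed.

(** Summing block by block counts the common sum once per block. This pins down the block sum once
    [sigma n] and the number of blocks are known. *)
Lemma layered_block_sum (k n : nat) (P : {set {set 'I_n.+1}})
    (A : {set 'I_n.+1}) :
    0 < n -> partition P (divisor_set n) ->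
    (forall B C : {set 'I_n.+1}, B \in P -> C \in P ->
       \sum_(d in B) val d = \sum_(d in C) val d) ->
    A \in P ->
  #|P| * \sum_(d in A) val d = sigma n.
Proof.
move=> n_gt0 partP eq_sums AP.
rewrite -sum_divisor_set // (set_partition_big _ partP) -sum_nat_const.
by apply: eq_bigr => B BP; apply: eq_sums.
Qed.

Theorem theorem6p16 (p n : nat) (p_prime : prime p) (n_gt0 : 0 < n)
    (n_coprime_p : gcdn n p = 1)
    (n_multiperfect : multiperfect p n) (n_layered : layered p n) :
  multiperfect p.+1 (p * n) /\ layered p.+1 (p * n).
Proof.
have p_gt0 := prime_gt0 p_prime.
have pn_gt0 : 0 < p * n by rewrite muln_gt0 p_gt0.
have le1 : 1 * n <= p * n by rewrite leq_mul2r p_gt0 orbT.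
have co_np : coprime n p by apply/eqP.
have [_ sigma_n] := n_multiperfect; have [_ [P [partP cardP eq_sums]]] := n_layered.
split; first by split; rewrite // sigma_prime_mul // sigma_n.
split=> //.
set f := scale_ord 1 (p * n) n; set g := scale_ord p (p * n) n.
have g_inj : injective g by apply: scale_ord_inj.
pose D := f @: divisor_set n.
pose Q := [set g @: (A : {set 'I_n.+1}) | A in P].
have partQ : partition Q (g @: divisor_set n) by rewrite imset_partition.
have disjD : [disjoint D & g @: divisor_set n].
  exact: disjoint_divisor_set_scale.
(* Blocks of a partition must be nonempty; the divisor 1 is the witness, and [inord 1] really is 1
   because [n > 0]. *)
have D_neq0 : D != set0.
  apply/set0Pn; exists (f (inord 1)); apply: imset_f.
  by rewrite mem_divisor_set // inordK ?dvd1n.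
(* A block of [Q] lies inside [g @: divisor_set n], so [D] would be disjoint from itself, hence
   empty. This makes [D] a genuinely new block in the count [p.+1]. *)
have D'Q : D \notin Q.
  apply/negP=> DQ; have := disjointWr (partitionS partQ DQ) disjD.
  by rewrite -setI_eq0 setIid (negPf D_neq0).
have sumDQ B : B \in D |: Q -> \sum_(d in B) val d = p * n.
  case/setU1P=> [->|/imsetP[A AP ->]].
    by rewrite sum_scale_ord // sum_divisor_set // sigma_n mul1n.
  (* The sum over [A] is [n]: multiplied by the number [p] of blocks it gives [sigma n = p * n], and
     [p] cancels. *)
  rewrite sum_scale_ord //; congr (p * _); apply/eqP.
  by rewrite -(eqn_pmul2l p_gt0) -sigma_n -{1}cardP layered_block_sum.
exists (D |: Q); split.
- by rewrite divisor_set_prime_mul // partitionU1.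
- by rewrite cardsU1 D'Q card_imset ?cardP //; apply: imset_inj.
- by move=> A B AQ BQ; rewrite !sumDQ.
Qed.
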